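(* Let $s\in\mathbb{N}$, $p,q\in[1,\infty]$, and $\alpha>0$. Then there exists a constant $c>0$, depending only on $\alpha,s,b$ and $q$, such that every cubature rule $Q(f)=\sum_{i=1}^N w_i f(\mathbf{x}_i)$ (with arbitrary points $\mathbf{x}_i\in[0,1)^s$ and arbitrary real weights $w_i$) that uses $N\ge3$ sample points satisfies $$e^{\mathrm{wor}}(Q,\widetilde{\mathcal{H}}_{\mathrm{wav},\alpha,s,p,q})\ge c\,N^{-\alpha}\ln(N)^{\frac{s-1}{q'}},$$ where $1/q+1/q'=1$ and $\widetilde{\mathcal{H}}_{\mathrm{wav},\alpha,s,p,q}$ denotes the subspace $\bigcup_{L\in\mathbb{N}_0}V^{s,L}$ of $\mathcal{H}_{\mathrm{wav},\alpha,s,p,q}$ endowed with the norm $\|\cdot\|_{\mathrm{wav},\alpha,s,p,q}$.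
   Context: Conventions: $1/\infty=0$, $r^{1/\infty}=1$. Fix an integer base $b\ge2$. Put $\Delta_{-1}=\{0\}$, $\Delta_j=\{0,\dots,b^j-1\}$ ($j\in\mathbb{N}_0$), $\nabla_0=\{0\}$, $\nabla_j=\{0,\dots,b-1\}$ ($j\ge1$). Univariate Haar functions: $\psi^0_{0,0}=1_{[0,1)}$ and for $j\ge1$, $i\in\nabla_j$, $k\in\Delta_{j-1}$: $\psi^j_{i,k}(x)=b^{j/2-1}\big(b\,1_{[b^{-j}(bk+i),b^{-j}(bk+i+1))}(x)-1_{[b^{1-j}k,b^{1-j}(k+1))}(x)\big)$. For $\mathbf{j}\in\mathbb{N}_0^s$: $|\mathbf{j}|=\sum_\ell j_\ell$, $\nabla_{\mathbf{j}}=\prod_\ell\nabla_{j_\ell}$, $\Delta_{\mathbf{j}-\mathbf{1}}=\prod_\ell\Delta_{j_\ell-1}$, $\Psi^{\mathbf{j}}_{\mathbf{i},\mathbf{k}}(\mathbf{x})=\prod_{\ell=1}^s\psi^{j_\ell}_{i_\ell,k_\ell}(x_\ell)$, $\langle f,g\rangle=\int_{[0,1]^s}fg$. For $q<\infty$: $\|f\|^q_{\mathrm{wav},\alpha,s,p,q}=\sum_{L=0}^\infty b^{q(\alpha-1/p+1/2)L}\sum_{|\mathbf{j}|=L}\big(\sum_{\mathbf{k}\in\Delta_{\mathbf{j}-\mathbf{1}}}\sum_{\mathbf{i}\in\nabla_{\mathbf{j}}}|\langle f,\Psi^{\mathbf{j}}_{\mathbf{i},\mathbf{k}}\rangle|^p\big)^{q/p}$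 (maximum instead of $\ell_p$-sum if $p=\infty$); for $q=\infty$: $\|f\|_{\mathrm{wav},\alpha,s,p,\infty}=\sup_{\mathbf{j}}b^{(\alpha-1/p+1/2)|\mathbf{j}|}(\sum_{\mathbf{k}}\sum_{\mathbf{i}}|\langle f,\Psi^{\mathbf{j}}_{\mathbf{i},\mathbf{k}}\rangle|^p)^{1/p}$. $\mathcal{H}_{\mathrm{wav},\alpha,s,p,q}$ is the space of $f\in L_1([0,1]^s)$ with finite norm (for $q=\infty$ additionally requiring that the wavelet series of $f$ converges pointwise to a function equal to $f$ a.e.). Approximation spaces: for $j\in\mathbb{N}_0$ let $V^j$ be the space of functions on $[0,1)$ constant on each interval $[kb^{-j},(k+1)b^{-j})$, $k\in\Delta_j$; for $L\in\mathbb{N}_0$, $V^{s,L}$ is the linear span of all functions $\mathbf{x}\mapsto\prod_{\ell=1}^s g_\ell(x_\ell)$ with $g_\ell\in V^{j_\ell}$ and $|\mathbf{j}|=L$. Elements of $V^{s,L}$ are finite linear combinations of indicator functions of half-open boxes, so point evaluation is well defined on them. For a normed function space $X$ and a cubature rule $Q$, $e^{\mathrm{wor}}(Q,X)=\sup\{|\int_{[0,1]^s}f-Q(f)|: f\in X,\|f\|_X\le1\}$. *)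

(* Defs.v *)
From HB Require Import structures.
From mathcomp Require Import all_boot all_order all_algebra.
From mathcomp Require Import all_classical all_reals all_analysis.
Set Implicit Arguments. Unset Strict Implicit. Unset Printing Implicit Defensive.
Import Order.TTheory GRing.Theory Num.Theory.
Local Open Scope classical_set_scope.
Local Open Scope ring_scope.

Section Defs.
Variable R : realType.

Definition ind (a c x : R) : R := if (a <= x) && (x < c) then 1 else 0.

Definition haar (b j i k : nat) (x : R) : R :=
  if j == 0%N then ind 0 1 x
  else (b%:R `^ (j%:R / 2 - 1)) *
       (b%:R * ind ((b * k + i)%:R / b%:R ^+ j) ((b * k + i).+1%:R / b%:R ^+ j) x
        - ind (k%:R / b%:R ^+ j.-1) (k.+1%:R / b%:R ^+ j.-1) x).

Definition Haar (b s : nat) (j i k : 'I_s -> nat) (x : 'I_s -> R) : R :=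
  \prod_(l < s) haar b (j l) (i l) (k l) (x l).

Definition upd (s : nat) (x : 'I_s -> R) (n : nat) (t : R) : 'I_s -> R :=
  fun l => if nat_of_ord l == n then t else x l.

Fixpoint iint (s n : nat) (f : ('I_s -> R) -> R) (x : 'I_s -> R) : R :=
  match n with
  | 0 => f x
  | n'.+1 => (\int[lebesgue_measure]_(t in `[0, 1]) iint n' f (upd x n' t))%R
  end.

Definition cube_int (s : nat) (f : ('I_s -> R) -> R) : R :=
  iint s f (fun _ => 0).

Definition ip (s : nat) (f g : ('I_s -> R) -> R) : R :=
  cube_int (fun x => f x * g x).

Definition einv (p : \bar R) : R :=
  match p with EFin r => r^-1 | _ => 0 end.

(* the (l_p-)norm of the block of wavelet coefficients at level vector j
   (max instead of l_p sum for p = oo).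
   k ranges over Delta_{j-1} (k_l < b^(j_l - 1), k_l = 0 if j_l = 0),
   i ranges over nabla_j (i_l < b, i_l = 0 if j_l = 0). *)
Definition idx_ok (b s : nat) (j : 'I_s -> nat) (i k : 'I_s -> nat) : bool :=
  [forall l, (k l < b ^ (j l).-1)%N && (i l < b)%N && ((j l == 0%N) ==> (i l == 0%N))].

Definition coef_block (b s : nat) (p : \bar R) (f : ('I_s -> R) -> R)
    (j : 'I_s -> nat) : R :=
  let M := (\sum_(l < s) j l).+1 in
  let c (k i : {ffun 'I_s -> 'I_(b ^ M)}) :=
    `| ip f (Haar b j (fun l => i l : nat) (fun l => k l : nat)) | in
  let ok (k i : {ffun 'I_s -> 'I_(b ^ M)}) :=
    idx_ok b j (fun l => i l : nat) (fun l => k l : nat) in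
  match p with
  | EFin r => (\sum_(k | true) \sum_(i | ok k i) c k i `^ r) `^ (r^-1)
  | _ => \big[Num.max/0]_(k | true) \big[Num.max/0]_(i | ok k i) c k i
  end.

Definition level_sum (s L : nat) (F : ('I_s -> nat) -> R) : R :=
  \sum_(j : {ffun 'I_s -> 'I_L.+1} | (\sum_(l < s) (j l : nat) == L)%N)
     F (fun l => j l : nat).

Definition wav_norm (b s : nat) (alpha : R) (p q : \bar R)
    (f : ('I_s -> R) -> R) : \bar R :=
  let e := alpha - einv p + 2^-1 in
  match q with
  | EFin r =>
      poweR (\sum_(0 <= L <oo)
               ((b%:R `^ (r * e * L%:R)) *
                level_sum L (fun j : 'I_s -> nat => coef_block b p f j `^ r))%:E)%E (r^-1)
  | _ => ereal_sup [set ((b%:R `^ (e * (\sum_(l < s) j l)%:R)) *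
                          coef_block b p f j)%:E | j in [set: 'I_s -> nat]]
  end.

(* V^j : functions on [0,1) constant on each [k b^-j, (k+1) b^-j), k < b^j,
   extended by zero outside [0,1) *)
Definition inV (b j : nat) (g : R -> R) : Prop :=
  (forall x, ~ (0 <= x /\ x < 1) -> g x = 0) /\
  (forall k : nat, (k < b ^ j)%N -> forall x y,
     k%:R / b%:R ^+ j <= x < k.+1%:R / b%:R ^+ j ->
     k%:R / b%:R ^+ j <= y < k.+1%:R / b%:R ^+ j -> g x = g y).

Definition inVsL (b s L : nat) (f : ('I_s -> R) -> R) : Prop :=
  exists (n : nat) (c : 'I_n -> R) (j : 'I_n -> 'I_s -> nat)
         (g : 'I_n -> 'I_s -> R -> R),
    (forall t, (\sum_(l < s) j t l)%N = L) /\
    (forall t l, inV b (j t l) (g t l)) /\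
    (forall x, f x = \sum_(t < n) c t * \prod_(l < s) g t l (x l)).

Definition unit_ball (b s : nat) (alpha : R) (p q : \bar R) :
    set (('I_s -> R) -> R) :=
  [set f | (exists L, inVsL b L f) /\ (wav_norm b alpha p q f <= 1)%E].

Definition cubature (s N : nat) (w : 'I_N -> R) (x : 'I_N -> 'I_s -> R)
    (f : ('I_s -> R) -> R) : R :=
  \sum_(i < N) w i * f (x i).

Definition e_wor (b s : nat) (alpha : R) (p q : \bar R)
    (N : nat) (w : 'I_N -> R) (x : 'I_N -> 'I_s -> R) : \bar R :=
  ereal_sup [set (`| cube_int f - cubature w x f |)%:E
            | f in unit_ball b alpha p q].

End Defs.

(* Main.v *)
Require Import Defs.
From HB Require Import structures.
From mathcomp Require Import all_boot all_order all_algebra.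
From mathcomp Require Import all_classical all_reals all_analysis.
From mathcomp Require Import measurable_realfun ring zify.
Import Order.TTheory GRing.Theory Num.Theory.
Local Open Scope classical_set_scope.
Local Open Scope ring_scope.

(** Fooling function argument. Choose [L] with [b^(L-1) <= 2N < b^L] and let [f]
    be a multiple of the sum, over all level vectors [j] with [|j| = L], of the
    indicators of those elementary boxes of shape [b^-j_1 x ... x b^-j_s] that
    contain no sample point. The cubature of [f] vanishes. For each [j] at least
    half of the [b^L] boxes are free, so the integral of the unscaled sum is at
    least [A/2], where [A] is the number of level vectors, of order [L^(s-1)].
    A box of shape [j] is orthogonal to [Psi^j'] unless [j' <= j], and there are
    at most [(L - |j'| + 1)^s] such [j]; hence the weighted coefficient block of
    the unscaled sum at [j'] is at most
    [2^s (L - |j'| + 1)^s b^(alpha |j'|) <= C b^(alpha L) y^(L - |j'|)] with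
    [y = b^(-alpha/2) < 1], uniformly in [p]. Summing over [j'], the norm of the
    unscaled sum is at most [C' A^(1/q) b^(alpha L)], and the quotient of integral
    and norm is the claimed bound. *)

(** * Integration of sums of product functions over the cube *)

Section CubeIntegral.
Variable R : realType.
Notation mu := (@lebesgue_measure R).
Notation integrable01 g := (mu.-integrable `[0, 1] (EFin \o g)).
Notation int01 g := (\int[mu]_(t in `[0, 1]) g t)%R.

Lemma integrable01_ind (a c : R) : integrable01 (ind a c).
Proof.
have -> : ind a c = \1_(`[a, c[ : set R) :> (R -> R).
  by apply/funext => x; rewrite /ind indicE mem_setE in_itv /=; case: ifP.
apply/integrableP; split.
  by apply/measurable_EFinP; apply: measurable_funTS.
under eq_integral => t _ do rewrite [abse _]/= ger0_norm //.
rewrite integral_indic //=; apply: (@le_lt_trans _ _ (mu `[0, 1])).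
  by apply: le_measure; rewrite ?inE //; apply: measurableI.
by rewrite lebesgue_measure_itv/= lte_fin ltr01 -EFinB ltry.
Qed.

Lemma int01_ind (a c : R) : 0 <= a -> a <= c -> c <= 1 -> int01 (ind a c) = c - a.
Proof.
move=> a0 ac c1; rewrite /Rintegral.
under eq_integral => x _.
  have -> : (ind a c x)%:E = (\1_(`[a, c[ : set R) x)%:E.
    by rewrite /ind indicE mem_setE in_itv /=; case: ifP.
  over.
rewrite integral_indic //= setIidl; last first.
  move=> x /=; rewrite !in_itv/= => /andP[ax xc].
  by rewrite (le_trans a0 ax) (le_trans (ltW xc) c1).
rewrite lebesgue_measure_itv/= lte_fin.
by case: ltgtP ac => //= -> _; rewrite subrr.
Qed.

Lemma ind_ge0 (a c x : R) : 0 <= ind a c x.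
Proof. by rewrite /ind; case: ifP. Qed.

Lemma ind_mul (a c a' c' x : R) :
  ind a c x * ind a' c' x = ind (Num.max a a') (Num.min c c') x.
Proof.
rewrite /ind ge_max lt_min.
by case: (a <= x); case: (a' <= x); case: (x < c); case: (x < c') => /=;
  rewrite ?mulr1 ?mulr0.
Qed.

Lemma eq_integrable01 {f g : R -> R} : f =1 g -> integrable01 g -> integrable01 f.
Proof. by move=> /funext ->. Qed.

Lemma integrable01Z (k : R) (g : R -> R) :
  integrable01 g -> integrable01 (fun x => k * g x).
Proof.
move=> ig; rewrite (_ : EFin \o _ = (fun x => k%:E * (EFin \o g) x)%E) //.
exact: integrableZl.
Qed.

Lemma integrable01B (f g : R -> R) :
  integrable01 f -> integrable01 g -> integrable01 (fun x => f x - g x).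
Proof.
move=> i1 i2; rewrite (_ : EFin \o _ = ((EFin \o f) \- (EFin \o g))%E) //.
exact: integrableB.
Qed.

Lemma integrable01_sum (I : Type) (r : seq I) (P : pred I) (g : I -> R -> R) :
  (forall t, integrable01 (g t)) ->
  integrable01 (fun x => \sum_(t <- r | P t) g t x).
Proof.
move=> ig; elim: r => [|a r IH].
  rewrite (_ : EFin \o _ = cst 0%E); first exact: integrable0.
  by apply/funext => x /=; rewrite big_nil.
case Pa: (P a).
  rewrite (_ : EFin \o _ = ((EFin \o g a) \+
    (EFin \o (fun x => (\sum_(t <- r | P t) g t x)%R)))%E).
    exact: integrableD.
  by apply/funext => x /=; rewrite big_cons Pa.
rewrite (_ : EFin \o _ = EFin \o (fun x => (\sum_(t <- r | P t) g t x)%R)) //.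
by apply/funext => x /=; rewrite big_cons Pa.
Qed.

Lemma int01_sum (I : Type) (r : seq I) (P : pred I) (g : I -> R -> R) :
  (forall t, integrable01 (g t)) ->
  int01 (fun x => \sum_(t <- r | P t) g t x) = \sum_(t <- r | P t) int01 (g t).
Proof.
move=> ig; elim: r => [|a r IH].
  under eq_Rintegral do rewrite big_nil.
  by rewrite big_nil Rintegral_cst // mul0r.
under eq_Rintegral do rewrite big_cons.
rewrite big_cons -IH; case: (P a) => //.
by rewrite RintegralD //; apply: integrable01_sum.
Qed.

(** By induction on the number of coordinates already integrated: each one-dimensional integration
    pulls out the factors in the other coordinates as constants. *)
Lemma cube_int_sum_prod (s : nat) (I : Type) (r : seq I) (P : pred I)
    (c : I -> R) (g : I -> 'I_s -> R -> R) :
  (forall t l, integrable01 (g t l)) ->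
  cube_int (fun x => \sum_(t <- r | P t) c t * \prod_(l < s) g t l (x l)) =
  \sum_(t <- r | P t) c t * \prod_(l < s) int01 (g t l).
Proof.
move=> ig; rewrite /cube_int.
set F := fun x : 'I_s -> R => _.
suff H n x : (n <= s)%N -> iint n F x =
    \sum_(t <- r | P t) c t *
      \prod_(l < s) (if (l < n)%N then int01 (g t l) else g t l (x l)).
  rewrite H //; apply: eq_bigr => t _; congr (_ * _).
  by apply: eq_bigr => l _; rewrite ltn_ord.
elim: n x => [//|n IH] x ns /=.
pose l0 := Ordinal ns.
transitivity (int01 (fun y : R => \sum_(t <- r | P t)
   (c t * \prod_(l < s | l != l0)
       (if (l < n.+1)%N then int01 (g t l) else g t l (x l))) * g t l0 y)).
  apply: eq_Rintegral => y _; rewrite IH 1?ltnW //.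
  apply: eq_bigr => t _; rewrite -mulrA; congr (_ * _).
  rewrite (bigD1 l0) //= ltnn /upd eqxx mulrC; congr (_ * _).
  apply: eq_bigr => l ll0; have nl : (l : nat) != n by [].
  by rewrite (negbTE nl) ltnS [(l <= n)%N]leq_eqVlt (negbTE nl).
rewrite int01_sum; last by move=> t; apply: integrable01Z.
apply: eq_bigr => t _; rewrite RintegralZl // -mulrA; congr (_ * _).
by rewrite [RHS](bigD1 l0) //= ltnSn mulrC.
Qed.

End CubeIntegral.

(** * Univariate Haar functions against b-adic intervals *)

Section HaarUnivariate.
Variable R : realType.
Notation mu := (@lebesgue_measure R).
Notation integrable01 g := (mu.-integrable `[0, 1] (EFin \o g)).
Notation int01 g := (\int[mu]_(t in `[0, 1]) g t)%R.
Variables (b : nat) (hb : (2 <= b)%N).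

(** Haar functions are linear combinations of these, so the univariate integrals below reduce to
    those of products of two cells. *)
Definition cell (j m : nat) (x : R) : R :=
  ind (m%:R / b%:R ^+ j) (m.+1%:R / b%:R ^+ j) x.

Let b_gt0 : 0 < b%:R :> R. Proof. by rewrite ltr0n; lia. Qed.
Let b_neq0 : b%:R != 0 :> R. Proof. exact: lt0r_neq0. Qed.
Let bX_gt0 j : 0 < b%:R ^+ j :> R. Proof. exact: exprn_gt0. Qed.

Lemma integrable01_cell j m : integrable01 (cell j m).
Proof. exact: integrable01_ind. Qed.

Lemma integrable01_cell_cell j m j' m' :
  integrable01 (fun x => cell j m x * cell j' m' x).
Proof.
by apply: eq_integrable01 => [x|]; [exact: ind_mul | exact: integrable01_ind].
Qed.

Lemma cellE j m x :
  cell j m x = if (m%:R <= x * b%:R ^+ j) && (x * b%:R ^+ j < m.+1%:R) then 1 else 0.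
Proof. by rewrite /cell /ind ler_pdivrMr // ltr_pdivlMr. Qed.

(** [x * b ^ j] lies in both [m, m + 1) and [m', m' + 1), which forces m < m' + 1 and m' < m + 1. *)
Lemma cell_neq0_inj {j m m' x} : cell j m x != 0 -> cell j m' x != 0 -> m = m'.
Proof.
rewrite !cellE; case: ifP => [/andP[h1 h2] _|]; last by rewrite eqxx.
case: ifP => [/andP[h3 h4] _|]; last by rewrite eqxx.
have := le_lt_trans h1 h4; have := le_lt_trans h3 h2; rewrite !ltr_nat; lia.
Qed.

Lemma cell_sum_le1 (n : nat) (P : pred 'I_n) j x :
  \sum_(m < n | P m) cell j m x <= 1.
Proof.
have [[m /andP[Pm nz]]|no] := pselect (exists m : 'I_n, P m && (cell j m x != 0)).
  rewrite (bigD1 m) //= big1 ?addr0; first by rewrite cellE; case: ifP.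
  move=> m' /andP[_ m'm]; apply/eqP; apply: contraNT m'm => nz'.
  by apply/eqP/val_inj/(cell_neq0_inj nz' nz).
rewrite big1 // => m Pm; apply/eqP/negPn/negP => nz.
by apply: no; exists m; rewrite Pm.
Qed.

Lemma int01_cell j m : (m < b ^ j)%N -> int01 (cell j m) = (b%:R ^+ j)^-1.
Proof.
move=> mj; rewrite int01_ind.
- by rewrite -mulrBl -natrB // subSnn mul1r.
- by rewrite divr_ge0 // ltW.
- by rewrite ler_pM2r ?invr_gt0 // ler_nat.
- by rewrite ler_pdivrMr // mul1r -natrX ler_nat.
Qed.

(* b-adic intervals are nested: the finer cell [k] lies in the coarser cell
   [k %/ b ^ d] and misses all the others. *)
Lemma cell_mul j d m k x :
  cell j m x * cell (j + d) k x =
  if (k %/ b ^ d == m)%N then cell (j + d) k x else 0.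
Proof.
have [->|nz] := eqVneq (cell (j + d) k x) 0; first by rewrite mulr0 if_same.
have h : cell j (k %/ b ^ d) x = 1.
  move: nz; rewrite !cellE; case: ifP => [/andP[h1 h2] _|]; last by rewrite eqxx.
  have bd : (0 < b ^ d)%N by rewrite expn_gt0; lia.
  move: h1 h2; rewrite exprD mulrA => h1 h2.
  have h3 : ((k %/ b ^ d)%:R * b%:R ^+ d <= k%:R :> R).
    by rewrite -natrX -natrM ler_nat leq_trunc_div.
  have h4 : (k.+1%:R <= (k %/ b ^ d).+1%:R * b%:R ^+ d :> R).
    by rewrite -natrX -natrM ler_nat ltn_ceil.
  rewrite -(ler_pM2r (bX_gt0 d)) (le_trans h3 h1) /=.
  by rewrite -(ltr_pM2r (bX_gt0 d)) (lt_le_trans h2 h4).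
case: eqP => [<-|ne]; first by rewrite h mul1r.
have [->|nz'] := eqVneq (cell j m x) 0; first by rewrite mul0r.
case: ne; apply: (cell_neq0_inj _ nz').
by rewrite h oner_neq0.
Qed.

Lemma int01_cell_cell j d m k :
  int01 (fun x => cell j m x * cell (j + d) k x) =
  if (k %/ b ^ d == m)%N then int01 (cell (j + d) k) else 0.
Proof.
under eq_Rintegral do rewrite cell_mul.
by case: ifP => // _; rewrite Rintegral_cst // mul0r.
Qed.

Lemma haarE j i k x : (0 < j)%N ->
  haar b j i k x = b%:R `^ (j%:R / 2 - 1) *
    (b%:R * cell j (b * k + i) x - cell j.-1 k x).
Proof. by case: j. Qed.

Lemma haar0E i k x : haar b 0 i k x = cell 0 0 x.
Proof. by rewrite /haar /cell /= expr0 !divr1. Qed.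

Lemma integrable01_cell_haar j m j' i k :
  integrable01 (fun x => cell j m x * haar b j' i k x).
Proof.
case: j' => [|j'].
  apply: eq_integrable01 (integrable01_cell_cell j m 0 0) => x.
  by rewrite haar0E.
pose g x := b%:R `^ (j'.+1%:R / 2 - 1) *
  (b%:R * (cell j m x * cell j'.+1 (b * k + i) x) - cell j m x * cell j' k x).
apply: (@eq_integrable01 _ _ g) => [x|].
  by rewrite haarE // mulrCA mulrBr [_ * (b%:R * _)]mulrCA.
apply: integrable01Z; apply: integrable01B; first apply: integrable01Z.
all: exact: integrable01_cell_cell.
Qed.

Lemma int01_cell_haarE j m j' i k : (0 < j')%N ->
  int01 (fun x => cell j m x * haar b j' i k x) =
  b%:R `^ (j'%:R / 2 - 1) *
    (b%:R * int01 (fun x => cell j m x * cell j' (b * k + i) x) -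
     int01 (fun x => cell j m x * cell j'.-1 k x)).
Proof.
move=> j'0; under eq_Rintegral do rewrite haarE // mulrCA mulrBr mulrCA.
have iA := integrable01_cell_cell j m j' (b * k + i).
have iB := integrable01_cell_cell j m j'.-1 k.
rewrite RintegralZl //; last by apply: integrable01B => //; apply: integrable01Z.
rewrite RintegralB //; last exact: integrable01Z.
by rewrite RintegralZl.
Qed.

(** A Haar function of level [j'] has mean zero and lives on one cell of level [j'.-1 >= j], which
    lies inside the cell [m] of level [j] or misses it. *)
Lemma int01_cell_haar_eq0 j m j' i k :
  (j < j')%N -> (k < b ^ j'.-1)%N -> (i < b)%N ->
  int01 (fun x => cell j m x * haar b j' i k x) = 0.
Proof.
move=> jj' kb ib; rewrite int01_cell_haarE; last by lia.
have [d j'E] : exists d, j' = (j + d.+1)%N by exists (j' - j.+1)%N; lia.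
have j'E1 : j'.-1 = (j + d)%N by lia.
have kbi : (b * k + i < b ^ j')%N.
  rewrite j'E addnS expnS -j'E1; move: kb; set B := (b ^ j'.-1)%N => kb; nia.
rewrite {2}j'E j'E1.
rewrite !int01_cell_cell.
(* As [i < b], both pieces of the Haar function have the same ancestor at level [j]: both
   contribute, and cancel, or neither does. *)
have -> : ((b * k + i) %/ b ^ d.+1 = k %/ b ^ d)%N.
  have b0 : (0 < b)%N by lia.
  by rewrite expnS divnMA [(b * k)%N]mulnC divnMDl // (divn_small ib) addn0.
case: ifP => _; last by rewrite mulr0 subrr mulr0.
rewrite -j'E -j'E1 !int01_cell // (_ : b%:R * _ = (b%:R ^+ j'.-1)^-1) ?subrr ?mulr0 //.
by rewrite j'E1 j'E addnS exprS invfM mulrA mulfV // mul1r.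
Qed.

Lemma sum_int01_cell (n : nat) (P : pred 'I_n) j (g : R -> R) :
  (forall m, integrable01 (fun x => cell j m x * g x)) ->
  integrable01 g -> (forall x, 0 <= g x) ->
  \sum_(m < n | P m) int01 (fun x => cell j m x * g x) <= int01 g.
Proof.
move=> icg ig g0; rewrite -int01_sum //; apply: le_Rintegral => //.
  by apply: integrable01_sum.
by move=> x _; rewrite -mulr_suml ler_piMl // cell_sum_le1.
Qed.

(** The cells are disjoint, so the sum is at most the sum of the L_1 norms of the two pieces of the
    Haar function. For positive [j'] each equals b^(j'/2 - 1) b^(1 - j') = b^(-j'/2). *)
Lemma sum_int01_cell_haar (n : nat) (P : pred 'I_n) j j' i k :
  (k < b ^ j'.-1)%N -> (i < b)%N ->
  \sum_(m < n | P m) `|int01 (fun x => cell j m x * haar b j' i k x)| <=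
  2 * b%:R `^ (- (j'%:R / 2)).
Proof.
(* Level 0 has a single piece, of integral 1; the factor 2 is slack there. *)
move=> kb ib; case: j' kb => [|j'] kb.
  rewrite mul0r oppr0 powRr0 mulr1.
  apply: (@le_trans _ _ 1); last by rewrite ler1n.
  apply: (@le_trans _ _ (int01 (cell 0 0))); last by rewrite int01_cell // expr0 invr1.
  apply: le_trans (sum_int01_cell _ P j (cell 0 0) _ _ _) => //; last 2 first.
  - exact: integrable01_cell.
  - by move=> x; apply: ind_ge0.
  - apply: ler_sum => m _; under eq_Rintegral do rewrite haar0E.
    by rewrite ger0_norm // Rintegral_ge0 // => x _; rewrite mulr_ge0 // ind_ge0.
  - by move=> m; apply: integrable01_cell_cell.
set K : R := b%:R `^ (j'.+1%:R / 2 - 1).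
have K0 : 0 <= K by apply: powR_ge0.
apply: (@le_trans _ _ (\sum_(m < n | P m)
   K * (b%:R * int01 (fun x => cell j m x * cell j'.+1 (b * k + i) x) +
        int01 (fun x => cell j m x * cell j' k x)))).
  apply: ler_sum => m _; rewrite int01_cell_haarE // normrM (ger0_norm K0).
  apply: ler_wpM2l => //; apply: le_trans (ler_normB _ _) _.
  have int_ge0 j1 m1 : 0 <= int01 (fun x => cell j m x * cell j1 m1 x).
    by apply: Rintegral_ge0 => x _; rewrite mulr_ge0 // ind_ge0.
  by rewrite !ger0_norm // mulr_ge0 // ltW.
rewrite -mulr_sumr big_split /= -mulr_sumr.
have kbi : (b * k + i < b ^ j'.+1)%N.
  by move: kb; rewrite /= expnS; set B := (b ^ j')%N => kb; nia.
apply: (@le_trans _ _ (K * (b%:R * (b%:R ^+ j'.+1)^-1 + (b%:R ^+ j')^-1))).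
  apply: ler_wpM2l => //; apply: lerD.
    apply: ler_wpM2l; first exact: ltW.
    rewrite -(int01_cell _ _ kbi); apply: sum_int01_cell.
    - by move=> m; apply: integrable01_cell_cell.
    - exact: integrable01_cell.
    - by move=> x; apply: ind_ge0.
  rewrite -(int01_cell _ _ kb); apply: sum_int01_cell.
  - by move=> m; apply: integrable01_cell_cell.
  - exact: integrable01_cell.
  - by move=> x; apply: ind_ge0.
have -> : b%:R * (b%:R ^+ j'.+1)^-1 = (b%:R ^+ j')^-1 :> R.
  by rewrite exprS invfM mulrA mulfV // mul1r.
have -> : (b%:R ^+ j')^-1 = b%:R `^ (- j'%:R) :> R by rewrite powR_invn // ltW.
rewrite -mulr2n -[_ *+ 2]mulr_natl mulrCA ler_pM2l // /K -powRD; last by rewrite b_neq0 implybT.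
by rewrite le_eqVlt; apply/orP; left; apply/eqP; congr (_ `^ _); rewrite -natr1; field.
Qed.

End HaarUnivariate.

(** * Counting level vectors and wavelet indices *)

Section Counting.
Local Open Scope nat_scope.

(** The entries of a vector with sum [L] are at most [L], so the finite type ['I_L.+1] loses
    none. *)
Definition level (s L : nat) : {set {ffun 'I_s -> 'I_L.+1}} :=
  [set j : {ffun 'I_s -> 'I_L.+1} | \sum_(l < s) j l == L].

(** Stars and bars, by passing to the tuples counted in [card_ord_partitions]. *)
Lemma card_level n L : #|level n.+1 L| = 'C(n + L, n).
Proof.
rewrite -card_ord_partitions.
pose g (j : {ffun 'I_n.+1 -> 'I_L.+1}) := [tuple j i | i < n.+1].
have g_inj : injective g.
  move=> j1 j2 e; apply/ffunP => i.
  by rewrite -(tnth_mktuple (fun i => j1 i) i) -/(g j1) e tnth_mktuple.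
rewrite -(card_imset _ g_inj); apply: eq_card => t; rewrite inE.
apply/imsetP/idP => [[j jL ->]|/eqP tL].
  move: jL; rewrite inE => /eqP jL; rewrite -[X in _ == X]jL big_tuple.
  by under eq_bigr do rewrite tnth_mktuple.
exists [ffun i => tnth t i].
  rewrite inE; apply/eqP; rewrite -[RHS]tL big_tuple.
  by apply: eq_bigr => i _; rewrite ffunE.
by apply: eq_from_tnth => i; rewrite tnth_mktuple ffunE.
Qed.

Lemma leq_card_level n L L' : L <= L' -> #|level n.+1 L| <= #|level n.+1 L'|.
Proof. by move=> LL'; rewrite !card_level leq_bin2l // leq_add2l. Qed.

Lemma card_level_gt0 n L : 0 < #|level n.+1 L|.
Proof. by rewrite card_level bin_gt0 leq_addr. Qed.

(** The right-hand side is the falling factorial (n + L) ... (L + 1), whose [n] factors are all at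
    least L + 1. *)
Lemma expn_le_card_level n L : L.+1 ^ n <= #|level n.+1 L| * n`!.
Proof.
rewrite card_level bin_ffact; elim: n => // n IH.
by rewrite expnS addSn ffactSS leq_mul // ltnS leq_addl.
Qed.

(** The shapes whose boxes need not be orthogonal to the Haar functions of level [j']. *)
Definition level_above (s L : nat) (j' : 'I_s -> nat) : {set {ffun 'I_s -> 'I_L.+1}} :=
  [set j in level s L | [forall l, j' l <= j l]].

Lemma level_above_eq0 s L (j' : 'I_s -> nat) :
  L < \sum_(l < s) j' l -> level_above s L j' = finset.set0.
Proof.
move=> Lj'; apply/setP => j; rewrite !inE; apply/negP => /andP[/eqP jL /forallP j'j].
have : \sum_(l < s) j' l <= \sum_(l < s) j l by apply: leq_sum => l _.
by rewrite jL leqNgt Lj'.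
Qed.

(** On this set [j] is determined by the differences [j l - j' l], which are nonnegative with sum L
    - |j'|, so each is at most L - |j'|. *)
Lemma card_level_above s L (j' : 'I_s -> nat) :
  #|level_above s L j'| <= (L - \sum_(l < s) j' l).+1 ^ s.
Proof.
set L' := \sum_(l < s) j' l.
pose g (j : {ffun 'I_s -> 'I_L.+1}) : {ffun 'I_s -> 'I_(L - L').+1} :=
  [ffun l => inord (j l - j' l)].
have bnd j l : j \in level_above s L j' -> j l - j' l < (L - L').+1.
  rewrite !inE => /andP[/eqP jL /forallP j'j]; rewrite ltnS.
  have -> : L - L' = \sum_(l < s) (j l - j' l).
    by rewrite sumnB ?jL.
  by rewrite (bigD1 l) //= leq_addr.
have g_inj : {in level_above s L j' &, injective g}.
  move=> j1 j2 h1 h2 /ffunP e; apply/ffunP => l; apply/val_inj.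
  have := congr1 val (e l); rewrite !ffunE /= !inordK ?bnd //.
  move: h1 h2; rewrite !inE => /andP[_ /forallP /(_ l) a1] /andP[_ /forallP /(_ l) a2].
  by move=> e'; rewrite /= -[LHS](subnK a1) e' subnK.
rewrite -(card_in_imset g_inj) (leq_trans (max_card _)) //.
by rewrite card_ffun !card_ord.
Qed.

Lemma card_ord_lt n k : k <= n -> #|[pred a : 'I_n | a < k]| = k.
Proof.
move=> kn; rewrite -sum1_card.
by rewrite -(big_ord_widen n (fun=> 1) kn) sum1_card card_ord.
Qed.

Lemma sum_ord_lt n k : \sum_(a < n | a < k) 1 <= k.
Proof.
have [kn|nk] := leqP k n; first by rewrite -(big_ord_widen n (fun=> 1) kn) sum1_card card_ord.
apply: leq_trans (ltnW nk); rewrite -[leqRHS](card_ord n) sum1_card; exact: max_card.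
Qed.

(** Each coordinate admits b^(j_l - 1) b pairs, or a single one if j_l = 0. Only an inequality
    holds, since a small [M] may cut off indices. *)
Lemma card_idx_ok b s M (j : 'I_s -> nat) :
  \sum_(k : {ffun 'I_s -> 'I_M}) \sum_(i : {ffun 'I_s -> 'I_M} |
     idx_ok b j (fun l => i l : nat) (fun l => k l : nat)) 1
  <= b ^ (\sum_(l < s) j l).
Proof.
pose P l (k i : 'I_M) := (k < b ^ (j l).-1) && (i < b) && ((j l == 0) ==> (i == 0 :> nat)).
have -> : \sum_(k : {ffun 'I_s -> 'I_M}) \sum_(i : {ffun 'I_s -> 'I_M} |
     idx_ok b j (fun l => i l : nat) (fun l => k l : nat)) 1 =
   \sum_(k : {ffun 'I_s -> 'I_M}) \sum_(i : {ffun 'I_s -> 'I_M})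
      \prod_(l < s) (P l (k l) (i l) : nat).
  apply: eq_bigr => k _; rewrite big_mkcond /=; apply: eq_bigr => i _.
  case: ifP => [/forallP h|/negbT].
    by rewrite big1 // => l _; rewrite /P h.
  rewrite negb_forall => /existsP[l /negbTE hl].
  by rewrite (bigD1 l) //= /P hl.
(* Distributivity turns the sums over functions into products of univariate sums, first for [i],
   then for [k]. *)
under eq_bigr do rewrite -(bigA_distr_bigA (fun l a => P l _ a : nat)).
rewrite -(bigA_distr_bigA (fun l k => \sum_a (P l k a : nat))).
rewrite expn_sum; apply: leq_prod => l _.
apply: (@leq_trans (\sum_(k < M | k < b ^ (j l).-1)
                      \sum_(i < M | i < (if j l == 0 then 1 else b)) 1)).
  rewrite [leqRHS]big_mkcond; apply: leq_sum => k _.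
  case: ifP => hk; last by rewrite big1 // => i _; rewrite /P hk.
  rewrite [leqRHS]big_mkcond; apply: leq_sum => i _; rewrite /P hk /=.
  case: (j l == 0) => /=; last by rewrite andbT; case: ifP.
  by case: (val i) => [|?] /=; rewrite ?andbT ?andbF ?leq_b1.
apply: (@leq_trans (\sum_(k < M | k < b ^ (j l).-1) (if j l == 0 then 1 else b))).
  by apply: leq_sum => k _; apply: sum_ord_lt.
rewrite -[X in \sum_(_ < _ | _) X]muln1 -big_distrr /= mulnC.
apply: leq_trans (leq_mul (sum_ord_lt _ _) (leqnn _)) _.
by case: (j l) => [|n] //=; rewrite expnSr.
Qed.

End Counting.

(** * Sums of elementary boxes and their wavelet coefficients *)

Section BoxSums.
Variable R : realType.
Notation mu := (@lebesgue_measure R).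
Notation int01 g := (\int[mu]_(t in `[0, 1]) g t)%R.
Variables (b : nat) (hb : (2 <= b)%N) (s L : nat).

(** A shape paired with a position. Positions below [b ^ L] suffice for every shape, as its entries
    are at most [L]; [level_boxes] selects the boxes of level [L] inside the cube. *)
Definition boxes : finType :=
  ({ffun 'I_s -> 'I_L.+1} * {ffun 'I_s -> 'I_(b ^ L)})%type.

Definition box (t : boxes) (x : 'I_s -> R) : R :=
  \prod_(l < s) cell R b (t.1 l) (t.2 l) (x l).

Definition level_boxes : {pred boxes} :=
  [pred t : boxes | (t.1 \in level s L) && [forall l, t.2 l < b ^ t.1 l]%N].

Definition box_sum (lam : R) (A : {pred boxes}) (x : 'I_s -> R) : R :=
  \sum_(t in A) lam * box t x.

Lemma inV_cell j m : (m < b ^ j)%N -> inV b j (cell R b j m).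
Proof.
move=> mj; split.
  move=> x; rewrite /cell /ind; case: ifP => // /andP[h1 h2] []; split.
    by apply: le_trans h1; rewrite divr_ge0 // exprn_ge0.
  apply: lt_le_trans h2 _; rewrite ler_pdivrMr ?mul1r -?natrX ?ler_nat //.
  by rewrite ltr0n expn_gt0; lia.
move=> k kj x y hx hy.
have hx' : cell R b j k x = 1 by rewrite /cell /ind hx.
have hy' : cell R b j k y = 1 by rewrite /cell /ind hy.
have [->|mk] := eqVneq m k; first by rewrite hx' hy'.
have H z : cell R b j k z = 1 -> cell R b j m z = 0.
  move=> hz; apply/eqP; apply: contraNT mk => nz; apply/eqP.
  by apply: (cell_neq0_inj _ _ hb nz); rewrite hz oner_neq0.
by rewrite !H.
Qed.

Lemma inVsL_box_sum lam A : {subset A <= level_boxes} -> inVsL b L (box_sum lam A).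
Proof.
move=> sA; exists #|A|, (fun=> lam),
  (fun (a : 'I_#|A|) l => (enum_val a).1 l : nat),
  (fun (a : 'I_#|A|) l => cell R b ((enum_val a).1 l) ((enum_val a).2 l)).
split=> [a|].
  by have /sA := enum_valP a; rewrite !inE => /andP[/eqP].
split=> [a l|x]; last by rewrite /box_sum big_enum_val.
by have /sA := enum_valP a; rewrite !inE => /andP[_ /forallP]; move/(_ l)/inV_cell.
Qed.

(** Every box of level [L] has volume b^(-L), whatever its shape. *)
Lemma cube_int_box_sum lam A : {subset A <= level_boxes} ->
  cube_int (box_sum lam A) = lam * #|A|%:R / b%:R ^+ L.
Proof.
move=> sA; rewrite [LHS](cube_int_sum_prod _ _ _ _ _ (fun=> lam)
  (fun (t : boxes) l => cell R b (t.1 l) (t.2 l))); last first.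
  by move=> t l; apply: integrable01_cell.
rewrite (eq_bigr (fun=> lam / b%:R ^+ L)).
  by rewrite sumr_const -[_ *+ #|_|]mulr_natl; ring.
move=> t /sA; rewrite !inE => /andP[/eqP tL /forallP tb]; congr (_ * _).
under eq_bigr => l _ do rewrite (int01_cell _ _ hb _ _ (tb l)).
by rewrite prodfV -expr_sum tL.
Qed.

(** A box whose shape is not above [j] drops out by orthogonality in one coordinate. For each
    remaining shape the sum over positions factorises into univariate sums, each at most 2
    b^(-j_l/2). *)
Lemma norm_ip_box_sum lam A j i k : 0 <= lam -> {subset A <= level_boxes} ->
  idx_ok b j i k ->
  `|ip (box_sum lam A) (Haar b j i k)| <=
  lam * 2 ^+ s * #|level_above s L j|%:R * b%:R `^ (- ((\sum_(l < s) j l)%N%:R / 2)).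
Proof.
move=> lam0 sA /forallP ok.
have kb l : (k l < b ^ (j l).-1)%N by case/andP: (ok l) => /andP[].
have ib l : (i l < b)%N by case/andP: (ok l) => /andP[].
pose h (t : boxes) l := int01 (fun x => cell R b (t.1 l) (t.2 l) x *
                                        haar b (j l) (i l) (k l) x).
have -> : ip (box_sum lam A) (Haar b j i k) = \sum_(t in A) lam * \prod_(l < s) h t l.
  rewrite -(cube_int_sum_prod _ _ _ _ _ (fun=> lam) (fun (t : boxes) l x =>
     cell R b (t.1 l) (t.2 l) x * haar b (j l) (i l) (k l) x)); last first.
    by move=> t l; apply: integrable01_cell_haar.
  rewrite /ip; congr cube_int; apply/funext => x.
  rewrite /box_sum mulr_suml; apply: eq_bigr => t _.
  by rewrite -mulrA -big_split.
apply: le_trans (ler_norm_sum _ _ _) _.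
(* Taking absolute values allows enlarging [A] to all positions of the shapes above [j], even those
   outside the cube. *)
apply: (@le_trans _ _ (\sum_(t : boxes | t.1 \in level_above s L j)
           lam * \prod_(l < s) `|h t l|)).
  rewrite big_mkcond [leRHS]big_mkcond; apply: ler_sum => t _.
  have pos : 0 <= lam * \prod_(l < s) `|h t l| by rewrite mulr_ge0 // prodr_ge0.
  case: ifP => [tA|_]; last by case: ifP.
  rewrite normrM normr_prod (ger0_norm lam0).
  case: ifP => // /negbT; have /andP[tL _] := sA _ tA.
  rewrite inE tL negb_forall => /existsP[l]; rewrite -ltnNge => jl.
  rewrite (bigD1 l) //= [h t l](int01_cell_haar_eq0 _ _ hb) //.
  by rewrite normr0 mul0r mulr0.
rewrite (_ : \sum_(t : boxes | _) _ =
  \sum_(a in level_above s L j) \sum_(c : {ffun 'I_s -> 'I_(b ^ L)})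
     lam * \prod_(l < s) `|h (a, c) l|); last first.
  by rewrite pair_big; apply: eq_big => [[a c]|[a c] _] //=; rewrite andbT.
have -> : lam * 2 ^+ s * #|level_above s L j|%:R *
    b%:R `^ (- ((\sum_(l < s) j l)%N%:R / 2)) =
  \sum_(a in level_above s L j)
     lam * (2 ^+ s * b%:R `^ (- ((\sum_(l < s) j l)%N%:R / 2))).
  by rewrite sumr_const -[_ *+ #|_|]mulr_natl; ring.
apply: ler_sum => a _; rewrite -mulr_sumr ler_wpM2l //.
rewrite -(bigA_distr_bigA (fun l (c : 'I_(b ^ L)) =>
   `|int01 (fun x => cell R b (a l) c x * haar b (j l) (i l) (k l) x)|)).
have -> : 2 ^+ s * b%:R `^ (- ((\sum_(l < s) j l)%N%:R / 2)) =
   \prod_(l < s) (2 * b%:R `^ (- ((j l)%:R / 2))) :> R.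
  rewrite big_split /= prodr_const card_ord; congr (_ * _).
  rewrite natr_sum mulr_suml -sumrN.
  apply: (big_ind2 (fun u v => b%:R `^ u = v)) => [|u1 v1 u2 v2 <- <-|//].
    by rewrite powRr0.
  by rewrite powRD // pnatr_eq0; apply/implyP => _; lia.
apply: ler_prod => l _; rewrite sumr_ge0 //=.
exact: (sum_int01_cell_haar _ _ hb).
Qed.

Lemma coef_block_ge0 (p : \bar R) f (j : 'I_s -> nat) : 0 <= coef_block b p f j.
Proof.
case: p => [r||] /=; first exact: powR_ge0.
all: by elim/big_ind: _ => [//|u v u0 v0|m _]; rewrite ?le_max ?u0 //;
  elim/big_ind: _ => [//|u v u0 v0|n _]; rewrite ?le_max ?u0.
Qed.

(** The block has at most b^|j| entries, each at most [B], so the l_p norm costs a factor b^(|j|/p),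
    which is 1 for infinite [p]. *)
Lemma coef_block_le (p : \bar R) f (j : 'I_s -> nat) (B : R) :
  (1%:E <= p)%E -> 0 <= B ->
  (forall i k, idx_ok b j i k -> `|ip f (Haar b j i k)| <= B) ->
  coef_block b p f j <= B * b%:R `^ (einv p * (\sum_(l < s) j l)%N%:R).
Proof.
case: p => [r||] //= hp B0 HB; last first.
  rewrite mul0r powRr0 mulr1.
  elim/big_ind: _ => [//|u v u0 v0|m _]; first by rewrite ge_max u0.
  elim/big_ind: _ => [//|u v u0 v0|n ok]; first by rewrite ge_max u0.
  exact: HB.
rewrite lee_fin in hp.
have r0 : 0 < r by apply: lt_le_trans hp.
set S := \sum_(l < s) j l.
have b0 : 0 <= b%:R :> R by [].
have -> : B * b%:R `^ (r^-1 * S%:R) = (b%:R `^ S%:R * B `^ r) `^ r^-1.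
  rewrite powRM ?powR_ge0 // -!powRrM mulfV ?lt0r_neq0 // powRr1 // mulrC.
  by rewrite [r^-1 * _]mulrC.
apply: ge0_ler_powR; first by rewrite invr_ge0 ltW.
- by rewrite nnegrE; do 2 apply: sumr_ge0 => ? _; apply: powR_ge0.
- by rewrite nnegrE mulr_ge0 ?powR_ge0.
apply: (@le_trans _ _ (\sum_(m : {ffun 'I_s -> 'I_(b ^ S.+1)})
   \sum_(n : {ffun 'I_s -> 'I_(b ^ S.+1)} |
     idx_ok b j (fun l => n l : nat) (fun l => m l : nat)) B `^ r)).
  apply: ler_sum => m _; apply: ler_sum => n ok.
  by apply: ge0_ler_powR; rewrite ?nnegrE ?(ltW r0) //; apply: HB.
have -> : \sum_(m : {ffun 'I_s -> 'I_(b ^ S.+1)})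
   \sum_(n : {ffun 'I_s -> 'I_(b ^ S.+1)} |
     idx_ok b j (fun l => n l : nat) (fun l => m l : nat)) B `^ r =
   (\sum_(m : {ffun 'I_s -> 'I_(b ^ S.+1)})
   \sum_(n : {ffun 'I_s -> 'I_(b ^ S.+1)} |
     idx_ok b j (fun l => n l : nat) (fun l => m l : nat)) 1)%N%:R * B `^ r.
  rewrite natr_sum mulr_suml; apply: eq_bigr => m _.
  by rewrite natr_sum mulr_suml; apply: eq_bigr => n _; rewrite mul1r.
rewrite ler_wpM2r ?powR_ge0 // powR_mulrn // -natrX ler_nat.
exact: card_idx_ok.
Qed.

End BoxSums.

(** * Boxes that avoid all sample points *)

Section FreeBoxes.
Variable R : realType.
Variables (b : nat) (hb : (2 <= b)%N) (s L : nat).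

(** The boxes of one fixed shape [j] of level [L] tile the cube, and there are b^|j| = b^L of
    them. *)
Lemma card_level_boxes : #|level_boxes b s L| = (#|level s L| * b ^ L)%N.
Proof.
rewrite -sum1_card.
transitivity (\sum_(j in level s L) \sum_(m : {ffun 'I_s -> 'I_(b ^ L)} |
     [forall l, m l < b ^ j l]%N) 1)%N.
  by rewrite pair_big_dep; apply: eq_big => [[j m]|].
rewrite -sum_nat_const; apply: eq_bigr => j; rewrite inE => /eqP jL.
transitivity (\sum_(m in family (fun l => [pred a : 'I_(b ^ L) | a < b ^ j l]%N))
    \prod_(l < s) 1)%N.
  by apply: eq_big => [m|m _]; rewrite ?big1.
rewrite -(bigA_distr_big_dep (fun l (a : 'I_(b ^ L)) => a < b ^ j l)%N (fun _ _ => 1%N)).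
transitivity (\prod_(l < s) b ^ j l)%N; last by rewrite -expn_sum jL.
apply: eq_bigr => l _; rewrite sum1_card card_ord_lt // leq_exp2l //.
by rewrite -ltnS.
Qed.

Variables (N : nat) (x : 'I_N -> 'I_s -> R).

Definition free_boxes : {pred boxes b s L} :=
  [pred t in level_boxes b s L | [forall a, box R b s L t (x a) == 0]].

(* A level vector and a sample point determine at most one box that contains the
   point. *)
Lemma card_free_boxes :
  (#|level s L| * b ^ L <= #|free_boxes| + #|level s L| * N)%N.
Proof.
rewrite -card_level_boxes.
pose hit := [pred t in level_boxes b s L | [exists a, box R b s L t (x a) != 0]].
have -> : #|level_boxes b s L| = (#|free_boxes| + #|hit|)%N.
  rewrite -(cardID [pred t | [forall a, box R b s L t (x a) == 0]]).
  by congr (_ + _)%N; apply: eq_card => t; rewrite !inE // negb_forall andbC.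
rewrite leq_add2l.
have [->//|/card_gt0P[t0 /andP[_ /existsP[a0 _]]]] := posnP #|hit|.
(* The default [a0] only makes [g] total: on [hit] the [pick] succeeds. *)
pose g (t : boxes b s L) :=
  (t.1, odflt a0 [pick a | box R b s L t (x a) != 0]).
have g_inj : {in hit &, injective g}.
  move=> [j m] [j' m'] /andP[_ /existsP[a ha]] /andP[_ /existsP[a' ha']] [].
  case: pickP => [c hc|/(_ a)]; last by rewrite ha.
  case: pickP => [c' hc'|/(_ a')]; last by rewrite ha'.
  move=> /= jj' cc'; subst j' c'; congr (_, _); apply/ffunP => l; apply: val_inj.
  move/prodf_neq0: hc => /(_ l isT) hc; move/prodf_neq0: hc' => /(_ l isT).
  exact: (cell_neq0_inj R b hb hc).
rewrite -(card_in_imset g_inj) -[in leqRHS](card_ord N) -cardsT -cardsX.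
apply: subset_leq_card; apply/fintype.subsetP => _ /imsetP[t /andP[/andP[tL _] _] ->].
by rewrite !inE /= andbT; rewrite inE in tL.
Qed.

Lemma cubature_free_boxes lam (w : 'I_N -> R) :
  cubature w x (box_sum R b s L lam free_boxes) = 0.
Proof.
rewrite /cubature big1 // => a _; rewrite /box_sum big1 ?mulr0 // => t /andP[_ /forallP].
by move=> /(_ a)/eqP ->; rewrite mulr0.
Qed.

End FreeBoxes.

(** * Norm estimate from bounds on the coefficient blocks *)

Section NormBound.
Variable R : realType.

(** For t = ln(beta) (m + 1) / (s + 1), t <= expR t and 1 <= expR t give t^s <= (expR t)^(s + 1) =
    beta^(m + 1). The denominator s + 1 covers s = 0. *)
Lemma poly_le_geometric (s : nat) (beta : R) : 1 < beta ->
  exists K : R, 0 < K /\ forall m : nat, m.+1%:R ^+ s <= K * beta ^+ m.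
Proof.
move=> b1; have b0 : 0 < beta by apply: lt_trans b1.
have d0 : 0 < ln beta by apply: ln_gt0.
exists (beta * (s.+1%:R / ln beta) ^+ s); split.
  by rewrite mulr_gt0 // exprn_gt0 // divr_gt0.
move=> m; set d := ln beta in d0 *.
have e0 : 0 <= d * m.+1%:R / s.+1%:R by rewrite divr_ge0 // mulr_ge0 // ltW.
have h1 : (d * m.+1%:R / s.+1%:R) ^+ s <= beta ^+ m.+1.
  apply: (@le_trans _ _ (expR (d * m.+1%:R / s.+1%:R) ^+ s)).
    apply: lerXn2r; rewrite ?nnegrE ?expR_ge0 //.
    by apply: le_trans (expR_ge1Dx _); rewrite lerDr.
  apply: (@le_trans _ _ (expR (d * m.+1%:R / s.+1%:R) ^+ s.+1)).
    rewrite ler_weXn2l //; apply: le_trans (expR_ge1Dx _); rewrite lerDl //.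
  rewrite -expRM_natl mulrC divfK ?pnatr_eq0 // mulrC expRM_natl lnK //.
have -> : m.+1%:R ^+ s = (s.+1%:R / d) ^+ s * (d * m.+1%:R / s.+1%:R) ^+ s :> R.
  rewrite -exprMn; congr (_ ^+ _); field.
  by rewrite (lt0r_neq0 d0) /= addrC natr1 pnatr_eq0.
rewrite [leRHS]mulrAC -exprS [leRHS]mulrC ler_wpM2l //.
by rewrite exprn_ge0 // divr_ge0 // ltW.
Qed.

(* The factor [y ^+ (L.+1 - n)] (truncated subtraction) only serves the induction
   on [n]. *)
Lemma truncated_geometric_sum_le (y : R) (L n : nat) : 0 < y -> y < 1 ->
  \sum_(0 <= m < n) (if (m <= L)%N then y ^+ (L - m) else 0) <=
  (1 - y)^-1 * y ^+ (L.+1 - n).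
Proof.
move=> y0 y1; have y1' : 0 < 1 - y by rewrite subr_gt0.
elim: n => [|n IH].
  by rewrite big_nil mulr_ge0 ?invr_ge0 ?exprn_ge0 // ltW.
rewrite big_nat_recr //=; case: ifP => nL; last first.
  by rewrite addr0; have -> : (L.+1 - n.+1 = L.+1 - n)%N by lia.
apply: (@le_trans _ _ ((1 - y)^-1 * y ^+ (L.+1 - n) + y ^+ (L - n))).
  by rewrite lerD2r.
rewrite subSn // subSS exprS le_eqVlt; apply/orP; left; apply/eqP.
field; exact: lt0r_neq0.
Qed.

Variables (b : nat) (hb : (2 <= b)%N) (n L : nat) (alpha : R).
Notation s := n.+1.

(** The decay b^(-alpha (L - |j|)) is beta^(-2 (L - |j|)): one power beta^(L - |j|) absorbs the
    polynomial factor, the other makes the sum over levels converge. *)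
Let beta : R := b%:R `^ (alpha / 2).

Hypothesis beta1 : 1 < beta.

Lemma wav_norm_le1 (p q : \bar R) (f : ('I_s -> R) -> R) (D K : R) :
  (1%:E <= q)%E -> 0 <= D -> 0 < K ->
  (forall m : nat, m.+1%:R ^+ s <= K * beta ^+ m) ->
  (forall j : 'I_s -> nat, coef_block b p f j <=
     if (\sum_(l < s) j l <= L)%N then
       D * (L - \sum_(l < s) j l).+1%:R ^+ s *
         b%:R `^ ((einv p - 2^-1) * (\sum_(l < s) j l)%N%:R)
     else 0) ->
  D * K * (1 - beta^-1)^-1 * #|level s L|%:R `^ einv q * beta ^+ (2 * L) <= 1 ->
  (wav_norm b alpha p q f <= 1)%E.
Proof.
move=> hq D0 K0 HK Hcoef Hone.
have b0 : 0 < b%:R :> R by rewrite ltr0n; lia.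
have bt0 : 0 < beta by apply: lt_trans beta1.
set y := beta^-1; have y0 : 0 < y by rewrite invr_gt0.
have y1 : y < 1 by rewrite invf_lt1.
have G1 : 1 <= (1 - y)^-1.
  by rewrite invf_ge1 ?subr_gt0 // gerBl ltW.
set G := (1 - y)^-1 in G1 Hone.
have Gge0 : 0 <= G by apply: le_trans G1.
pose E := D * K * beta ^+ (2 * L).
have E0 : 0 <= E by rewrite /E !mulr_ge0 ?exprn_ge0 // ltW.
pose e := alpha - einv p + 2^-1.
have Hblock (j : 'I_s -> nat) :
    b%:R `^ (e * (\sum_(l < s) j l)%N%:R) * coef_block b p f j <=
    if (\sum_(l < s) j l <= L)%N then E * y ^+ (L - \sum_(l < s) j l) else 0.
  apply: le_trans (ler_wpM2l (powR_ge0 _ _) (Hcoef j)) _.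
  set S := (\sum_(l < s) j l)%N; case: ifP => SL; last by rewrite mulr0.
  (* The two exponents add up to [alpha], so [p] cancels here. *)
  have -> : b%:R `^ (e * S%:R) * (D * (L - S).+1%:R ^+ s *
       b%:R `^ ((einv p - 2^-1) * S%:R)) = D * (L - S).+1%:R ^+ s * beta ^+ (2 * S).
    rewrite mulrCA -powRD ?(lt0r_neq0 b0) ?implybT //; congr (_ * _).
    rewrite -powR_mulrn ?powR_ge0 // -powRrM natrM; congr (_ `^ _).
    by rewrite /e; field.
  have -> : E * y ^+ (L - S) = D * (K * beta ^+ (L - S)) * beta ^+ (2 * S).
    set M := (L - S)%N; have LE : (2 * L = 2 * S + (M + M))%N by rewrite /M; lia.
    rewrite /E LE !exprD /y exprVn; field.
    by rewrite expf_neq0 // lt0r_neq0.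
  by rewrite ler_wpM2r ?exprn_ge0 ?(ltW bt0) // ler_wpM2l.
(* For infinite [q] the cardinality factor in [Hone] is 1, and every weighted block is at most E <=
   E G <= 1. *)
case: q hq Hone => [r||] //= hq Hone; last first.
  apply: ub_ereal_sup => _ [j _ <-]; rewrite lee_fin.
  apply: le_trans (Hblock j) _; case: ifP => // _.
  apply: (@le_trans _ _ E); first by rewrite ler_piMr // exprn_ile1 // ltW.
  rewrite powRr0 mulr1 in Hone; apply: le_trans Hone.
  by rewrite /E [leRHS]mulrAC ler_peMr.
rewrite lee_fin in hq; have r0 : 0 < r by apply: lt_le_trans hq.
pose A : R := #|level s L|%:R.
have A0 : 0 < A by rewrite ltr0n card_level_gt0.
(* A level L' <= L has at most [A] vectors; as r >= 1 and y < 1, the r-th power of y^(L - L') is at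
   most y^(L - L'). *)
have term (L' : nat) : b%:R `^ (r * e * L'%:R) *
    level_sum L' (fun j : 'I_s -> nat => coef_block b p f j `^ r) <=
    A * E `^ r * (if (L' <= L)%N then y ^+ (L - L') else 0).
  rewrite /level_sum mulr_sumr.
  apply: (@le_trans _ _ (\sum_(j : {ffun 'I_s -> 'I_L'.+1} |
      (\sum_(l < s) (j l : nat) == L')%N)
      E `^ r * (if (L' <= L)%N then y ^+ (L - L') else 0))).
    apply: ler_sum => j /eqP jL.
    have -> : r * e * L'%:R = e * L'%:R * r by ring.
    rewrite powRrM -powRM ?powR_ge0 ?coef_block_ge0 //.
    have := Hblock (fun l => j l : nat); rewrite jL => Hj.
    have Hpos : 0 <= b%:R `^ (e * L'%:R) * coef_block b p f (fun l => j l : nat).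
      by rewrite mulr_ge0 ?powR_ge0 ?coef_block_ge0.
    have Hr := ge0_ler_powR (ltW r0) Hpos (le_trans Hpos Hj) Hj.
    apply: le_trans Hr _; case: ifP => // LL; last first.
      by rewrite mulr0 powR0 // lt0r_neq0.
    rewrite powRM // ?exprn_ge0 ?(ltW y0) // ler_wpM2l ?powR_ge0 //.
    by apply: ge1r_powR => //; rewrite exprn_gt0 // exprn_ile1 // ltW.
  rewrite sumr_const -[X in X <= _]mulr_natl -mulrA.
  case: ifP => LL; last by rewrite !mulr0.
  apply: ler_wpM2r; first by rewrite mulr_ge0 ?powR_ge0 ?exprn_ge0 // ltW.
  rewrite ler_nat; apply: leq_trans (leq_card_level _ _ _ LL).
  by apply: subset_leq_card; apply/fintype.subsetP => j; rewrite inE.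
(* The r-th power of [Hone] reads A E^r G^r <= 1, and G <= G^r because G, r >= 1. *)
have Hsum : A * E `^ r * G <= 1.
  have Hr : (E * G * A `^ r^-1) `^ r <= 1.
    have <- : 1 `^ r = 1 :> R by rewrite powR1.
    apply: ge0_ler_powR; rewrite ?nnegrE ?(ltW r0) //.
      by apply: mulr_ge0; [apply: mulr_ge0|exact: powR_ge0].
    apply: le_trans Hone; rewrite /E -/A le_eqVlt; apply/orP; left.
    by apply/eqP; ring.
  apply: le_trans Hr; have EG0 : 0 <= E * G by apply: mulr_ge0.
  rewrite (powRM _ EG0 (powR_ge0 _ _)) (powRM _ E0 Gge0) -powRrM.
  rewrite mulVf ?lt0r_neq0 // (powRr1 (ltW A0)) [leRHS]mulrC mulrA.
  apply: ler_wpM2l; first by rewrite mulr_ge0 ?powR_ge0 // ltW.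
  exact: le1r_powR.
rewrite -(poweR1r r^-1); apply: gt0_ler_poweR; first by rewrite invr_ge0 ltW.
- rewrite in_itv /= leey andbT; apply: nneseries_ge0 => m _ _; rewrite lee_fin.
  rewrite mulr_ge0 ?powR_ge0 // /level_sum sumr_ge0 // => j _; exact: powR_ge0.
- by rewrite in_itv /= lee01 leey.
(* It remains to bound the partial sums, each of which is at most A E^r G. *)
apply: lime_le.
  apply: is_cvg_nneseries => m _ _; rewrite lee_fin.
  rewrite mulr_ge0 ?powR_ge0 // /level_sum sumr_ge0 // => j _; exact: powR_ge0.
apply: nearW => m; rewrite sumEFin lee_fin.
apply: le_trans (ler_sum _ (fun i _ => term i)) _.
rewrite -mulr_sumr; apply: le_trans Hsum.
rewrite ler_wpM2l ?mulr_ge0 ?powR_ge0 ?(ltW A0) //.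
apply: le_trans (truncated_geometric_sum_le _ L _ y0 y1) _.
by rewrite ler_piMr // exprn_ile1 // ltW.
Qed.

End NormBound.

(** * Lower bound on the worst-case error at a fixed level *)

Section WorstCaseError.
Variable R : realType.
Variables (b : nat) (hb : (2 <= b)%N) (n : nat) (alpha : R) (halpha : 0 < alpha).
Variables (q : \bar R) (hq : (1%:E <= q)%E).
Notation s := n.+1.
Let beta : R := b%:R `^ (alpha / 2).
Variables (K : R) (K0 : 0 < K).
Hypothesis HK : forall m : nat, m.+1%:R ^+ s <= K * beta ^+ m.
Let G : R := (1 - beta^-1)^-1.
Let b_gt1 : 1 < b%:R :> R. Proof. by rewrite ltr1n. Qed.

Lemma geometric_ratio_gt1 : 1 < beta.
Proof.
rewrite -(powRr0 (b%:R : R)) /beta /powR gt_eqF ?(lt_trans _ b_gt1) //.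
by rewrite ltr_expR mul0r mulr_gt0 ?divr_gt0 // ln_gt0.
Qed.

Lemma e_wor_ge (p : \bar R) (hp : (1%:E <= p)%E) (N L : nat) (hN : (2 * N <= b ^ L)%N)
    (w : 'I_N -> R) (x : 'I_N -> 'I_s -> R) :
  (((2 ^+ s.+1 * K * G)^-1 * #|level s L|%:R `^ (1 - einv q) * (beta ^+ (2 * L))^-1)%:E
    <= e_wor b alpha p q w x)%E.
Proof.
have bt1 := geometric_ratio_gt1.
have bt0 : 0 < beta by apply: lt_trans bt1.
have b0 : 0 < b%:R :> R by apply: lt_trans b_gt1.
have G0 : 0 < G by rewrite invr_gt0 subr_gt0 invf_lt1.
have btL : 0 < beta ^+ (2 * L) by rewrite exprn_gt0.
pose A : R := #|level s L|%:R.
have A0 : 0 < A by rewrite ltr0n card_level_gt0.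
have Aq0 : 0 < A `^ einv q by rewrite powR_gt0.
(* Reciprocal of the norm bound for the unscaled sum, so that [f] lands in the unit ball. *)
pose lam := (2 ^+ s * K * G * A `^ einv q * beta ^+ (2 * L))^-1.
have lam0 : 0 < lam by rewrite invr_gt0 !mulr_gt0 ?exprn_gt0.
pose F := free_boxes R b s L N x.
have sF : {subset F <= level_boxes b s L} by move=> t /andP[].
pose f := box_sum R b s L lam F.
have ball_f : unit_ball b alpha p q f.
  split; first by exists L; apply: inVsL_box_sum.
  apply: (wav_norm_le1 R b hb n L alpha bt1 p q f (lam * 2 ^+ s) K) => //.
  - by rewrite mulr_ge0 ?exprn_ge0 // ltW.
  - move=> j; pose B : R := lam * 2 ^+ s * #|level_above s L j|%:R *
      b%:R `^ (- ((\sum_(l < s) j l)%N%:R / 2)).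
    have B0 : 0 <= B by rewrite /B !mulr_ge0 ?powR_ge0 ?exprn_ge0 // ltW.
    have H i k : idx_ok b j i k -> `|ip f (Haar b j i k)| <= B.
      by apply: norm_ip_box_sum => //; apply: ltW.
    apply: le_trans (coef_block_le _ b _ _ _ _ _ hp B0 H) _.
    case: leqP => jL; last first.
      by rewrite /B level_above_eq0 // cards0 mulr0 !mul0r.
    rewrite /B -!mulrA -powRD ?(lt0r_neq0 b0) ?implybT // !mulrA.
    rewrite (_ : - _ + _ = (einv p - 2^-1) * (\sum_(l < s) j l)%N%:R); last by field.
    rewrite ler_wpM2r ?powR_ge0 // ler_wpM2l ?mulr_ge0 ?exprn_ge0 ?(ltW lam0) //.
    by rewrite -natrX ler_nat card_level_above.
  rewrite -/beta -/G -/A.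
  set X := 2 ^+ s * K * G * A `^ einv q * beta ^+ (2 * L).
  have lamE : lam = X^-1 by [].
  have X0 : 0 < X by rewrite -invr_gt0 -lamE.
  have -> : lam * 2 ^+ s * K * G * A `^ einv q * beta ^+ (2 * L) = X^-1 * X.
    by rewrite lamE /X; ring.
  by rewrite mulVf // lt0r_neq0.
apply: (@le_trans _ _ (`|cube_int f - cubature w x f|)%:E); last first.
  by apply: ereal_sup_ubound; exists f.
rewrite cubature_free_boxes subr0 cube_int_box_sum // lee_fin.
apply: le_trans (ler_norm _).
have bL : 0 < b%:R ^+ L :> R by rewrite exprn_gt0.
(* Since 2N <= b^L, the sample points hit at most half of the boxes. *)
have hF : A * b%:R ^+ L <= 2 * #|F|%:R.
  rewrite -natrX -!natrM ler_nat.
  have := card_free_boxes R b hb s L N x; rewrite -/F.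
  have : (#|level s L| * (2 * N) <= #|level s L| * b ^ L)%N by rewrite leq_mul2l hN orbT.
  set a1 := (#|level s L| * b ^ L)%N; rewrite mulnCA; set a2 := (#|level s L| * N)%N.
  set a3 := #|F|; clearbody a1 a2 a3; clear; lia.
(* The division by 2 raises 2^s to 2^(s + 1), and A / A^(1/q) gives the exponent 1 - 1/q. *)
apply: (@le_trans _ _ (lam * A / 2)).
  rewrite powRB; last by rewrite (lt0r_neq0 A0) implybT.
  rewrite powRr1 ?(ltW A0) // le_eqVlt; apply/orP; left; apply/eqP.
  rewrite /lam exprS; field.
  by rewrite !lt0r_neq0 ?exprn_gt0.
rewrite -mulrA -[leRHS]mulrA ler_pM2l // ler_pdivlMr // mulrAC ler_pdivrMr //.
by rewrite [leRHS]mulrC.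
Qed.

End WorstCaseError.

(** * Choice of the level and of the constant *)

Theorem theorem3 (R : realType) (b : nat) (hb : (2 <= b)%N)
    (s : nat) (hs : (1 <= s)%N) (alpha : R) (halpha : 0 < alpha)
    (q : \bar R) (hq : (1%:E <= q)%E) :
  exists c : R, 0 < c /\
    forall (p : \bar R), (1%:E <= p)%E ->
    forall (N : nat), (3 <= N)%N ->
    forall (w : 'I_N -> R) (x : 'I_N -> 'I_s -> R),
      (forall i l, 0 <= x i l < 1) ->
      ((c * N%:R `^ (- alpha) * ln N%:R `^ ((s.-1)%:R * (1 - einv q)))%:E
         <= e_wor b alpha p q w x)%E.
Proof.
case: s hs => // n _ /=.
pose beta : R := b%:R `^ (alpha / 2).
have b_gt1 : 1 < b%:R :> R by rewrite ltr1n.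
have b_gt0 : 0 < b%:R :> R by apply: lt_trans b_gt1.
have bt1 : 1 < beta := geometric_ratio_gt1 R b hb alpha halpha.
have [K [K0 HK]] := poly_le_geometric R n.+1 beta bt1.
have G0 : 0 < (1 - beta^-1)^-1.
  by rewrite invr_gt0 subr_gt0 invf_lt1 // (lt_trans _ bt1).
set G := (1 - beta^-1)^-1 in G0.
have th0 : 0 <= 1 - einv q.
  case: q hq => [r||] /= hr; rewrite ?subr0 ?ler01 //.
  by rewrite subr_ge0 invf_le1 // (lt_le_trans ltr01).
set th := 1 - einv q in th0 *.
pose Z : R := (n`!%:R * ln b%:R ^+ n) `^ th.
have lnb : 0 < ln b%:R :> R by apply: ln_gt0.
have Z0 : 0 < Z by rewrite powR_gt0 // mulr_gt0 ?exprn_gt0 // ltr0n fact_gt0.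
have C0 : 0 < 2 ^+ n.+2 * K * G by rewrite mulr_gt0 // mulr_gt0 // exprn_gt0.
have P0 : 0 < (2 * b%:R) `^ alpha :> R by rewrite powR_gt0 // mulr_gt0.
(* The factors are the constant of [e_wor_ge], the loss in replacing b^L by N ([hbeta]), and the
   loss in replacing the number of level vectors by ln(N)^n ([hln]). *)
exists ((2 ^+ n.+2 * K * G)^-1 * ((2 * b%:R) `^ alpha)^-1 * Z^-1); split.
  by rewrite !mulr_gt0 ?invr_gt0.
move=> p hp N hN w x _.
(* The least [L] with 2N < b^L; hence also b^L <= 2bN. *)
pose L := (trunc_log b (2 * N)).+1.
have N1 : (0 < N)%N by apply: leq_trans hN.
have N2 : (0 < 2 * N)%N by rewrite muln_gt0.
have /andP[lo hi] := trunc_log_bounds hb N2.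
have N0 : 0 < N%:R :> R by rewrite ltr0n.
apply: le_trans (e_wor_ge R b hb n alpha halpha q hq K K0 HK p hp N L (ltnW hi) w x).
rewrite -/beta -/G -/th lee_fin.
set A : R := #|level n.+1 L|%:R.
have A0 : 0 < A by rewrite ltr0n card_level_gt0.
(* This is beta^(2L) = (b^L)^alpha <= (2bN)^alpha, inverted. *)
have hbeta : (beta ^+ (2 * L))^-1 >= ((2 * b%:R) `^ alpha)^-1 * N%:R `^ (- alpha).
  rewrite powRN -invfM lef_pV2 ?posrE ?exprn_gt0 ?(lt_trans _ bt1) //; last first.
    by apply: mulr_gt0 => //; apply: powR_gt0.
  rewrite -powRM // ?mulr_ge0 // /beta -powR_mulrn ?powR_ge0 // -powRrM natrM.
  rewrite (_ : alpha / 2 * (2 * L%:R) = L%:R * alpha); last by field.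
  rewrite powRrM powR_mulrn //; apply: ge0_ler_powR;
    rewrite ?nnegrE ?exprn_ge0 ?mulr_ge0 ?(ltW halpha) //.
  rewrite -natrX -!natrM ler_nat.
  by rewrite expnS [(2 * b)%N]mulnC -mulnA leq_mul2l lo orbT.
(* From N <= b^L, ln N <= (L + 1) ln b; then (L + 1)^n <= n! A, and everything is raised to the
   power [th]. *)
have hln : Z^-1 * ln N%:R `^ (n%:R * th) <= A `^ th.
  rewrite mulrC ler_pdivrMr //.
  have lnN0 : 0 <= ln N%:R :> R by apply: ln_ge0; rewrite ler1n.
  rewrite /Z -powRM ?(ltW A0) //; last by rewrite mulr_ge0 // exprn_ge0 // ltW.
  rewrite powRrM powR_mulrn //; apply: ge0_ler_powR => //; rewrite ?nnegrE.
  - by rewrite exprn_ge0.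
  - by rewrite !mulr_ge0 ?exprn_ge0 // ltW.
  have lnN : ln N%:R <= L.+1%:R * ln b%:R :> R.
    apply: (@le_trans _ _ (ln (b%:R ^+ L))).
      rewrite ler_ln ?posrE ?exprn_gt0 // -natrX ler_nat.
      by apply: leq_trans (ltnW hi); rewrite leq_pmull.
    by rewrite lnXn // -[X in X <= _]mulr_natl ler_pM2r // ler_nat.
  apply: (@le_trans _ _ ((L.+1%:R * ln b%:R) ^+ n)).
    by apply: lerXn2r; rewrite ?nnegrE // mulr_ge0 // ltW.
  rewrite exprMn mulrA ler_pM2r ?exprn_gt0 // -natrX -natrM ler_nat.
  exact: expn_le_card_level.
set u := N%:R `^ _ in hbeta *; set v := ln _ `^ _ in hln *.
rewrite (_ : _ * u * v = (2 ^+ n.+2 * K * G)^-1 *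
  ((Z^-1 * v) * (((2 * b%:R) `^ alpha)^-1 * u))); last by ring.
rewrite -[leRHS]mulrA ler_pM2l ?invr_gt0 //; apply: ler_pM => //.
  by rewrite mulr_ge0 ?invr_ge0 ?powR_ge0 // ltW.
by rewrite mulr_ge0 ?invr_ge0 ?powR_ge0.
Qed.
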